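(* Consider the following time-allocation model. Task durations $X_1,X_2,\dots$ are i.i.d. copies of a random variable $X$ with values in $[0,C]$, $C>0$, with law unknown to the agent. The reward function $r:[0,C]\to[E,D]$, $E\le 0\le D$, is known to the agent. Idle times $S_1,S_2,\dots$ are i.i.d. exponential with known parameter $\lambda>0$, independent of the durations. At step $n$ the agent waits $S_n$, observes $X_n$, and decides $a_n\in\{0,1\}$; if $a_n=1$ she is busy for time $X_n$ and earns reward $r(X_n)$. Let $\theta=\min\{n:\sum_{i=1}^n(S_i+X_ia_i)>T\}$, let the expected reward of the policy be $U(T)=\mathbb{E}[\sum_{n=1}^\theta r(X_n)a_n]$, and its regret $R(T)=c^*T-U(T)$, where $c^*$ is the unique root on $\mathbb{R}_+$ of $\Phi(c)=\lambda\mathbb{E}[(r(X)-cX)_+]-c$. Consider the policy (Algorithm 1) which, upon receiving the $n$-th proposal $X_n$, computes $c_n$, the unique root on $\mathbb{R}_+$ of $\Phi_n(c)=\lambda\frac1n\sum_{i=1}^n(r(X_i)-cX_i)_+-c$, and accepts the task if and only if $r(X_n)\ge c_nX_n$, until the total elapsed time exceeds $T$. Then its regret satisfies $$R(T)\le \lambda(D-E)C\sqrt{\tfrac{\pi}{2}}\sqrt{\lambda T+1}.$$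
   Context: $(z)_+=\max\{z,0\}$; $\pi$ in the bound denotes the number $3.14159\ldots$. *)

(* Defs.v *)
From HB Require Import structures.
From mathcomp Require Import all_boot all_order all_algebra.
From mathcomp Require Import all_classical all_reals all_analysis.
Import Order.TTheory GRing.Theory Num.Def Num.Theory.
Local Open Scope classical_set_scope.
Local Open Scope ring_scope.

Section model.
Context {d : measure_display} {Omega : measurableType d} {R : realType}.

Definition mutually_independent {I : eqType} (P : probability Omega R)
    (Z : I -> Omega -> R) : Prop :=
  forall (J : seq I) (B : I -> set R), uniq J ->
    (forall j, measurable (B j)) ->
    P (\big[setI/setT]_(j <- J) (Z j @^-1` B j)) =
    (\prod_(j <- J) fine (P (Z j @^-1` B j)))%:E.

Definition posp (z : R) : R := Num.max z 0.

(** c_n (0-indexed: computed at step n from X_0, ..., X_n, i.e. n+1 samples):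
    the root on R_+ of Phi_n(c) = lam * 1/(n+1) sum_{i<=n} (r(X_i) - c X_i)_+ - c *)
Definition alg_c (lam : R) (r : R -> R) (X : nat -> Omega -> R) (n : nat)
    (w : Omega) : R :=
  xget 0 [set c : R | 0 <= c /\
    lam * ((n.+1)%:R^-1 * \sum_(i < n.+1) posp (r (X i w) - c * X i w)) - c = 0].

Definition alg_a (lam : R) (r : R -> R) (X : nat -> Omega -> R) (n : nat)
    (w : Omega) : R :=
  if alg_c lam r X n w * X n w <= r (X n w) then 1 else 0.

Definition elapsed (lam : R) (r : R -> R) (X S : nat -> Omega -> R) (n : nat)
    (w : Omega) : R :=
  \sum_(i < n.+1) (S i w + X i w * alg_a lam r X i w).

Definition theta (lam T : R) (r : R -> R) (X S : nat -> Omega -> R)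
    (w : Omega) : nat :=
  xget 0%N [set n : nat | T < elapsed lam r X S n w /\
    forall m : nat, (m < n)%N -> elapsed lam r X S m w <= T].

Definition total_reward (lam T : R) (r : R -> R) (X S : nat -> Omega -> R)
    (w : Omega) : R :=
  \sum_(n < (theta lam T r X S w).+1) r (X n w) * alg_a lam r X n w.

Definition U (P : probability Omega R) (lam T : R) (r : R -> R)
    (X S : nat -> Omega -> R) : \bar R :=
  'E_P[total_reward lam T r X S].

Definition cstar (P : probability Omega R) (lam : R) (r : R -> R)
    (X0 : Omega -> R) : R :=
  xget 0 [set c : R | 0 <= c /\
    lam * fine ('E_P[fun w => posp (r (X0 w) - c * X0 w)]) - c = 0].

Definition regret (P : probability Omega R) (lam T : R) (r : R -> R)
    (X S : nat -> Omega -> R) : \bar R :=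
  ((cstar P lam r (X 0%N) * T)%:E - U P lam T r X S)%E.

End model.

(* Main.v *)
(** Comparing the horizon with the elapsed time and applying Wald's identity
    reduces the regret to the sum, over the proposals made before the horizon, of
    (r(X_n) - cstar X_n)_+ - (r(X_n) - cstar X_n) a_n <= C |c_n - cstar|.  Since Phi_n
    decreases with slope at most -1, |c_n - cstar| <= |Phi_n(cstar)|, which is lam
    times the deviation of an empirical mean of n+1 i.i.d. variables with values
    in [0, D]; its expectation is at most lam D / (2 sqrt(n+1)) by the variance
    bound.  The number of proposals is correlated with these deviations, but it is
    dominated by the number N of idle times (truncated at 2/lam) needed to exceed
    T, which is independent of the durations.  Wald's identity for the truncated
    idle times gives E[N] <= M := 4/3 (lam T + 2), so the sum is at most
    lam C D (sqrt M - 1/2), and this is below the claimed bound because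
    pi/2 >= 4/3. *)

Require Import Defs.
From HB Require Import structures.
From mathcomp Require Import all_boot all_order all_algebra.
From mathcomp Require Import all_classical all_reals all_analysis.
From mathcomp Require Import measurable_realfun ring lra.
Import Order.TTheory GRing.Theory Num.Def Num.Theory.
Import numFieldNormedType.Exports.
Local Open Scope classical_set_scope.
Local Open Scope ring_scope.
Set Implicit Arguments.
Unset Strict Implicit.
Unset Printing Implicit Defensive.

(** * Independence of sigma-algebras generated by disjoint sets of coordinates *)

Section independence.
Context {d : measure_display} {Omega : measurableType d} {R : realType}.
Context (P : probability Omega R) {I : eqType} (Z : I -> Omega -> R).

(** The condition [B j = setT] off [s] makes the family visibly stable under
    intersection. *)
Definition cylinders (J : set I) : set (set Omega) :=
  [set A | exists s (B : I -> set R), [/\ uniq s, forall j, j \in s -> J j,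
    forall j, measurable (B j), forall j, j \notin s -> B j = setT &
    A = [set w | forall j, B j (Z j w)]]].

(** Expresses that [f] depends only on the coordinates in [J]. *)
Definition sub_measurable (J : set I) (f : Omega -> R) :=
  measurable_fun (setT : set (g_sigma_algebraType (cylinders J))) f.

Lemma cylindersI J : setI_closed (cylinders J).
Proof.
move=> _ _ [s [B [us sJ mB BT ->]]] [s' [B' [us' sJ' mB' BT' ->]]].
exists (undup (s ++ s')), (fun j => B j `&` B' j); split.
- exact: undup_uniq.
- by move=> j; rewrite mem_undup mem_cat => /orP[/sJ|/sJ'].
- by move=> j; exact: measurableI.
- move=> j; rewrite mem_undup mem_cat negb_or => /andP[js js'].
  by rewrite BT// BT'// setTI.
- by apply/seteqP; split=> w /= => [[h h'] j|h]; split => // j; case: (h j).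
Qed.

Lemma cylinder_bigsetI (s : seq I) (B : I -> set R) :
  (forall j, j \notin s -> B j = setT) ->
  [set w | forall j, B j (Z j w)] = \big[setI/setT]_(j <- s) (Z j @^-1` B j).
Proof.
move=> BT; have E w : (\big[setI/setT]_(j <- s) (Z j @^-1` B j)) w <->
    (forall j, j \in s -> B j (Z j w)).
  elim: (s) => [|i t IH]; first by rewrite big_nil; split.
  rewrite big_cons; split=> [[/= Bi /IH h] j|h].
    by rewrite inE => /predU1P[->|/h].
  by split; [apply: h|apply/IH => j jt; apply: h]; rewrite inE ?eqxx ?jt ?orbT.
apply/seteqP; split=> w /=; rewrite E => h j //.
by have [js|js] := boolP (j \in s); [exact: h|rewrite BT].
Qed.

Hypothesis mZ : forall j, measurable_fun setT (Z j).

Lemma measurable_cylinder J A : cylinders J A -> measurable A.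
Proof.
move=> [s [B [_ _ mB BT ->]]]; rewrite (cylinder_bigsetI BT).
by apply: bigsetI_measurable => j _; rewrite -[X in measurable X]setTI; exact: mZ.
Qed.

Lemma sigma_cylinder_measurable J A : <<s cylinders J >> A -> measurable A.
Proof.
apply: smallest_sub => [|B]; last exact: measurable_cylinder.
exact: sigma_algebra_measurable.
Qed.

Lemma sub_measurableW J f : sub_measurable J f -> measurable_fun setT f.
Proof.
by move=> mf _ B mB; exact: (@sigma_cylinder_measurable J) (mf measurableT B mB).
Qed.

Lemma sub_measurable_coord (J : set I) j : J j -> sub_measurable J (Z j).
Proof.
move=> Jj _ B mB; apply: sub_sigma_algebra.
exists [:: j], (fun i => if i == j then B else setT); split => //.
- by move=> i; rewrite inE => /eqP ->.
- by move=> i; case: ifP.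
- by move=> i; rewrite inE => /negbTE ->.
- rewrite setTI; apply/seteqP; split=> w /= => [h i|/(_ j)].
    by case: eqP => [->|].
  by rewrite eqxx.
Qed.

Lemma sub_measurable_mono (J K : set I) f :
  J `<=` K -> sub_measurable J f -> sub_measurable K f.
Proof.
move=> JK mf _ B mB; have := mf measurableT B mB.
apply: smallest_sub => [|A [s [D [us sJ mD DT ->]]]].
  exact: smallest_sigma_algebra.
by apply: sub_sigma_algebra; exists s, D; split => // j /sJ /JK.
Qed.

(** Dynkin's pi-lambda argument: the events independent of a fixed [A] are closed under complements
    and countable disjoint unions. *)
Lemma indep_sigma_half (G : set (set Omega)) A :
  setI_closed G -> (forall B, <<s G >> B -> measurable B) -> measurable A ->
  (forall B, G B -> P (A `&` B) = (P A * P B)%E) ->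
  forall B, <<s G >> B -> P (A `&` B) = (P A * P B)%E.
Proof.
move=> GI mG mA AG.
have indepC (B : set Omega) : measurable B -> P (A `&` B) = (P A * P B)%E ->
    P (A `&` ~` B) = (P A * P (~` B))%E.
  move=> mB AB; have -> : P (A `&` ~` B) = (P A - P (A `&` B))%E.
    rewrite -setDE; apply: measureD => //.
    by rewrite (le_lt_trans (probability_le1 P mA)) ?ltry.
  have -> : P (~` B) = (1 - P B)%E by exact: probability_setC.
  rewrite AB -(fineK (fin_num_measure P A mA)) -(fineK (fin_num_measure P B mB)).
  set a := fine _; set b := fine _.
  by rewrite -[RHS]/((a * (1 - b))%:E) mulrBr mulr1.
have indepU (F : (set Omega)^nat) : (forall n, measurable (F n)) ->
    trivIset setT F -> (forall n, P (A `&` F n) = (P A * P (F n))%E) ->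
    P (A `&` \bigcup_k F k) = (P A * P (\bigcup_k F k))%E.
  move=> mF tF AF; rewrite setI_bigcupr.
  have tAF : trivIset setT (fun n => A `&` F n) by apply: trivIset_setIl.
  rewrite !measure_semi_bigcup//=; last 3 first.
  - by apply: bigcup_measurable.
  - by move=> n; exact: measurableI.
  - by apply: bigcup_measurable => n _; exact: measurableI.
  under eq_eseriesr do rewrite AF.
  by rewrite -(fineK (fin_num_measure P A mA)) nneseriesZl.
apply: (@dynkin_induction _ (g_sigma_algebraType G) G) => //.
- by rewrite setIT probability_setT mule1.
- by move=> B mB; apply: indepC; exact: mG.
- by move=> F mF tF AF; exact: (indepU F (fun n => mG _ (mF n)) tF AF).
Qed.

Hypothesis indepZ : mutually_independent P Z.

(** The pi-lambda argument is applied to each side in turn. Two cylinders over disjoint index lists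
    remain, and for these the claim is the product formula over the concatenated list. *)
Lemma indep_sigma (J K : set I) A B : J `&` K = set0 ->
  <<s cylinders J >> A -> <<s cylinders K >> B -> P (A `&` B) = (P A * P B)%E.
Proof.
move=> JK sA sB.
apply: (@indep_sigma_half (cylinders K)) => //.
- exact: cylindersI.
- exact: sigma_cylinder_measurable.
- exact: sigma_cylinder_measurable sA.
move=> {sB} {}B cB; rewrite setIC muleC.
apply: (@indep_sigma_half (cylinders J)) => //.
- exact: cylindersI.
- exact: sigma_cylinder_measurable.
- exact: measurable_cylinder cB.
move=> {sA} {}A cA; rewrite setIC muleC.
move: cA cB => [s [D [us sJ mD DT AE]]] [s' [D' [us' sK mD' DT' BE]]].
have dis j : j \in s -> j \in s' -> False.
  by move=> /sJ Jj /sK Kj; have : (J `&` K) j by []; rewrite JK.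
have ABE : A `&` B = \big[setI/setT]_(j <- s ++ s') (Z j @^-1` (D j `&` D' j)).
  rewrite -(@cylinder_bigsetI _ (fun j => D j `&` D' j)).
    rewrite AE BE.
    by apply/seteqP; split=> w /= => [[h h'] j|h]; split => // j; case: (h j).
  by move=> j; rewrite mem_cat negb_or => /andP[js js']; rewrite DT// DT'// setTI.
have {}AE : A = \big[setI/setT]_(j <- s) (Z j @^-1` D j).
  by rewrite AE; exact: cylinder_bigsetI.
have {}BE : B = \big[setI/setT]_(j <- s') (Z j @^-1` D' j).
  by rewrite BE; exact: cylinder_bigsetI.
rewrite ABE AE BE !indepZ//; last 2 first.
- rewrite cat_uniq us us' andbT/=; apply/hasPn => j js'.
  by apply/negP => js; exact: (dis j).
- by move=> j; exact: measurableI.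
rewrite big_cat/= EFinM; congr (_%:E * _%:E)%E.
- apply: eq_big_seq => j js; rewrite DT' ?setIT//.
  by apply/negP => js'; exact: (dis j).
- apply: eq_big_seq => j js'; rewrite DT ?setTI//.
  by apply/negP => js; exact: (dis j).
Qed.

End independence.

(** * Expectations of bounded measurable functions *)

Section bounded_measurable.
Context {d : measure_display} {Omega : measurableType d} {R : realType}.
Context (P : probability Omega R).
Implicit Types (f g : Omega -> R) (c : R).
Local Notation Ex f := (Rintegral P setT f).

Definition bounded_measurable (f : Omega -> R) :=
  measurable_fun setT f /\ exists M : R, forall w, `|f w| <= M.

Lemma bmf_cst c : bounded_measurable (fun=> c).
Proof. by split; [exact: measurable_cst|exists `|c|]. Qed.

Lemma bmfD f g : bounded_measurable f -> bounded_measurable g ->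
  bounded_measurable (fun w => f w + g w).
Proof.
move=> [mf [M fM]] [mg [N gN]]; split; first exact: measurable_funD.
by exists (M + N) => w; rewrite (le_trans (ler_normD _ _))// lerD.
Qed.

Lemma bmfM f g : bounded_measurable f -> bounded_measurable g ->
  bounded_measurable (fun w => f w * g w).
Proof.
move=> [mf [M fM]] [mg [N gN]]; split; first exact: measurable_funM.
by exists (M * N) => w; rewrite normrM ler_pM.
Qed.

Lemma bmfZ c f : bounded_measurable f -> bounded_measurable (fun w => c * f w).
Proof. by apply: bmfM; exact: bmf_cst. Qed.

Lemma bmfB f g : bounded_measurable f -> bounded_measurable g ->
  bounded_measurable (fun w => f w - g w).
Proof.
move=> bf bg; rewrite (_ : (fun w => _) = (fun w => f w + -1 * g w)).
  by apply: bmfD => //; exact: bmfZ.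
by apply/funext => w; rewrite mulN1r.
Qed.

Lemma bmf_sum n (F : nat -> Omega -> R) :
  (forall i, bounded_measurable (F i)) ->
  bounded_measurable (fun w => \sum_(i < n) F i w).
Proof.
move=> bF; elim: n => [|n IH].
  by under eq_fun do rewrite big_ord0; exact: bmf_cst.
by under eq_fun do rewrite big_ord_recr/=; exact: bmfD.
Qed.

Lemma bmf_norm f : bounded_measurable f -> bounded_measurable (fun w => `|f w|).
Proof.
move=> [mf [M fM]]; split; first exact: measurableT_comp.
by exists M => w; rewrite normr_id.
Qed.

Lemma bmf_indic A : measurable A -> bounded_measurable (\1_A).
Proof.
move=> mA; split; first exact: measurable_indic.
by exists 1 => w; rewrite indicE normr_nat; case: (_ \in _).
Qed.

Lemma bmf_integrable f : bounded_measurable f -> P.-integrable setT (EFin \o f).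
Proof.
move=> [mf [M fM]]; apply: measurable_bounded_integrable => //.
  by rewrite (le_lt_trans (probability_le1 P measurableT)) ?ltry.
exists M; split; first exact: num_real.
by move=> N MN w _; exact: le_trans (fM w) (ltW MN).
Qed.

Lemma ExD f g : bounded_measurable f -> bounded_measurable g ->
  Ex (fun w => f w + g w) = Ex f + Ex g.
Proof. by move=> bf bg; apply: RintegralD => //; exact: bmf_integrable. Qed.

Lemma ExB f g : bounded_measurable f -> bounded_measurable g ->
  Ex (fun w => f w - g w) = Ex f - Ex g.
Proof. by move=> bf bg; apply: RintegralB => //; exact: bmf_integrable. Qed.

Lemma ExZ c f : bounded_measurable f -> Ex (fun w => c * f w) = c * Ex f.
Proof. by move=> bf; apply: RintegralZl => //; exact: bmf_integrable. Qed.

Lemma Ex_cst c : Ex (fun=> c) = c.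
Proof.
rewrite Rintegral_cst// -[RHS]mulr1; congr *%R.
exact: (congr1 fine (probability_setT P)).
Qed.

Lemma Ex_le f g : bounded_measurable f -> bounded_measurable g ->
  (forall w, f w <= g w) -> Ex f <= Ex g.
Proof.
move=> bf bg fg.
by apply: le_Rintegral => //; exact: bmf_integrable.
Qed.

Lemma Ex_sum n (F : nat -> Omega -> R) :
  (forall i, bounded_measurable (F i)) ->
  Ex (fun w => \sum_(i < n) F i w) = \sum_(i < n) Ex (F i).
Proof.
move=> bF; elim: n => [|n IH].
  by under eq_Rintegral do rewrite big_ord0; rewrite Ex_cst big_ord0.
under eq_Rintegral do rewrite big_ord_recr/=.
by rewrite ExD// ?IH ?big_ord_recr//; exact: bmf_sum.
Qed.

Lemma EFin_Ex f : bounded_measurable f ->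
  (Ex f)%:E = (\int[P]_w (f w)%:E)%E.
Proof. by move=> /bmf_integrable bf; rewrite fineK// integrable_fin_num. Qed.

Lemma Ex_indic A : measurable A -> Ex (\1_A) = fine (P A).
Proof. by move=> mA; rewrite /Rintegral integral_indic// setIT. Qed.

Lemma Ex_ge0 f : (forall w, 0 <= f w) -> 0 <= Ex f.
Proof. by move=> f0; exact: Rintegral_ge0. Qed.

(** By uniqueness of product measures, the law of [(f, g)] is the product of the two laws; Tonelli
    then splits the integral. *)
Lemma ge0_Ex_prod f g : bounded_measurable f -> bounded_measurable g ->
  (forall w, 0 <= f w) -> (forall w, 0 <= g w) ->
  (forall A B, measurable A -> measurable B ->
    P (f @^-1` A `&` g @^-1` B) = (P (f @^-1` A) * P (g @^-1` B))%E) ->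
  Ex (fun w => f w * g w) = Ex f * Ex g.
Proof.
move=> bf bg f0 g0 indep; have [mf _] := bf; have [mg _] := bg.
pose F : {mfun Omega >-> R} := HB.pack f (isMeasurableFun.Build _ _ _ _ f mf).
pose G : {mfun Omega >-> R} := HB.pack g (isMeasurableFun.Build _ _ _ _ g mg).
have mfg : measurable_fun setT (fun w => (f w, g w)) by exact: measurable_fun_pair.
pose FG : {mfun Omega >-> (R * R)%type} :=
  HB.pack (fun w => (f w, g w)) (isMeasurableFun.Build _ _ _ _ _ mfg).
have joint X : measurable X ->
    (distribution P F \x distribution P G)%E X = distribution P FG X.
  by apply: product_measure_unique => A B mA mB; exact: indep.
(* Integration against the laws requires an integrand that is nonnegative on all of [R]; [pos]
   agrees with the identity on the values of [f] and [g]. *)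
pose pos (x : R) : \bar R := (Num.max x 0)%:E.
have mpos : measurable_fun setT pos.
  by apply/measurable_EFinP; exact: measurable_maxr.
have pos_ge0 x : (0 <= pos x)%E by rewrite lee_fin le_max lexx orbT.
have posE x : 0 <= x -> pos x = x%:E by move=> x0; rewrite /pos max_l.
have EF : (\int[distribution P F]_x pos x = (Ex f)%:E)%E.
  rewrite ge0_integral_distribution// EFin_Ex//.
  by apply: eq_integral => w _; rewrite /= posE.
have EG : (\int[distribution P G]_x pos x = (Ex g)%:E)%E.
  rewrite ge0_integral_distribution// EFin_Ex//.
  by apply: eq_integral => w _; rewrite /= posE.
apply: EFin_inj; rewrite EFinM -EF -EG EFin_Ex; last exact: bmfM.
have mposM : measurable_fun setT (fun z : R * R => pos z.1 * pos z.2)%E.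
  by apply: emeasurable_funM; apply: measurableT_comp.
transitivity (\int[distribution P FG]_z (pos z.1 * pos z.2))%E.
  rewrite ge0_integral_distribution//; last by move=> z; rewrite mule_ge0.
  by apply: eq_integral => w _; rewrite /= !posE// EFinM.
transitivity (\int[distribution P F \x distribution P G]_z (pos z.1 * pos z.2))%E.
  by apply: eq_measure_integral => X mX _; exact/esym/joint.
rewrite fubini_tonelli1//=; last by move=> z; rewrite mule_ge0.
rewrite /fubini_F/=.
under eq_integral do rewrite ge0_integralZl//.
by rewrite ge0_integralZr// integral_ge0.
Qed.

(** Adding constants reduces the signed case to [ge0_Ex_prod]. *)
Lemma Ex_prod f g : bounded_measurable f -> bounded_measurable g ->
  (forall A B, measurable A -> measurable B ->
    P (f @^-1` A `&` g @^-1` B) = (P (f @^-1` A) * P (g @^-1` B))%E) ->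
  Ex (fun w => f w * g w) = Ex f * Ex g.
Proof.
move=> bf bg indep; have [_ [M fM]] := bf; have [_ [N gN]] := bg.
have shift (a : R) (B : set R) : measurable B -> measurable ((fun x => x + a) @^-1` B).
  move=> mB; rewrite -[X in measurable X]setTI.
  have : measurable_fun setT (fun x : R => x + a) by exact: measurable_funD.
  by apply.
have bfM : bounded_measurable (fun w => f w + M) by apply: bmfD => //; exact: bmf_cst.
have bgN : bounded_measurable (fun w => g w + N) by apply: bmfD => //; exact: bmf_cst.
have := @ge0_Ex_prod (fun w => f w + M) (fun w => g w + N) bfM bgN.
rewrite !ExD//; [|exact: bmf_cst..]; rewrite !Ex_cst.
have -> : Ex (fun w => (f w + M) * (g w + N)) =
    Ex (fun w => f w * g w + (N * f w + (M * g w + M * N))).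
  by apply: eq_Rintegral => w _; ring.
rewrite ExD; [|exact: bmfM|]; last first.
  by apply: bmfD; [exact: bmfZ|apply: bmfD; [exact: bmfZ|exact: bmf_cst]].
rewrite ExD; [|exact: bmfZ|by apply: bmfD; [exact: bmfZ|exact: bmf_cst]].
rewrite ExD; [|exact: bmfZ|exact: bmf_cst].
rewrite Ex_cst !ExZ// => H; suff : Ex (fun w => f w * g w) +
   (N * Ex f + (M * Ex g + M * N)) = (Ex f + M) * (Ex g + N) by lra.
apply: H.
- by move=> w; rewrite -lerBlDr sub0r lerNl (le_trans _ (fM w))// -normrN ler_norm.
- by move=> w; rewrite -lerBlDr sub0r lerNl (le_trans _ (gN w))// -normrN ler_norm.
- move=> A B mA mB.
  exact: (indep _ _ (shift M A mA) (shift N B mB)).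
Qed.

(** Both sides integrate the extension of [h] by zero against the common law. The set [D] appears
    because the reward function is assumed measurable on [[0, C]] only. *)
Lemma ge0_Ex_same_law (h : R -> R) (D : set R) (X Y : Omega -> R) :
  measurable D -> measurable_fun D h -> (forall x, D x -> 0 <= h x) ->
  measurable_fun setT X -> measurable_fun setT Y ->
  (forall w, D (X w)) -> (forall w, D (Y w)) ->
  (forall B, measurable B -> P (X @^-1` B) = P (Y @^-1` B)) ->
  Ex (h \o X) = Ex (h \o Y).
Proof.
move=> mD mh h0 mX mY DX DY XY.
pose F : {mfun Omega >-> R} := HB.pack X (isMeasurableFun.Build _ _ _ _ X mX).
pose G : {mfun Omega >-> R} := HB.pack Y (isMeasurableFun.Build _ _ _ _ Y mY).
have mhD : measurable_fun setT (EFin \o (h \_ D)).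
  by apply/measurable_EFinP; exact: (measurable_restrictT _ mD).1 mh.
have hD0 y : (0 <= (EFin \o (h \_ D)) y)%E.
  by rewrite /= lee_fin patchE; case: ifPn => [/set_mem/h0|]//.
rewrite /Rintegral; congr fine.
transitivity (\int[distribution P F]_x ((EFin \o (h \_ D)) x))%E.
  rewrite ge0_integral_distribution//.
  by apply: eq_integral => w _; rewrite /= patchE mem_set.
transitivity (\int[distribution P G]_x ((EFin \o (h \_ D)) x))%E.
  by apply: eq_measure_integral => B mB _; exact: XY.
rewrite ge0_integral_distribution//.
by apply: eq_integral => w _; rewrite /= patchE mem_set.
Qed.

Context {I : eqType} (Z : I -> Omega -> R).
Hypothesis mZ : forall j, measurable_fun setT (Z j).
Hypothesis indepZ : mutually_independent P Z.

Lemma Ex_prod_indep (J K : set I) f g : J `&` K = set0 ->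
  sub_measurable Z J f -> sub_measurable Z K g ->
  bounded_measurable f -> bounded_measurable g ->
  Ex (fun w => f w * g w) = Ex f * Ex g.
Proof.
move=> JK mf mg bf bg; apply: Ex_prod => // A B mA mB.
apply: (indep_sigma mZ indepZ JK).
- by have := mf measurableT _ mA; rewrite setTI.
- by have := mg measurableT _ mB; rewrite setTI.
Qed.

End bounded_measurable.

(** * Fixed points of nonincreasing functions, and numerical inequalities *)

Section real_lemmas.
Context {R : realType}.

Lemma lipschitz_continuousT (h : R -> R) (K : R) :
  (forall x y, `|h x - h y| <= K * `|x - y|) -> continuous h.
Proof.
move=> hK x; apply/cvgrPdist_le => e e0; near=> y.
have K1 : 0 < `|K| + 1 by rewrite ltr_wpDl.
rewrite (le_trans (hK _ _))// (@le_trans _ _ ((`|K| + 1) * `|x - y|))//.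
  by rewrite ler_wpM2r// (le_trans (ler_norm _))// lerDl.
rewrite -ler_pdivlMl//; near: y.
by apply: cvgr_dist_le => //; rewrite mulr_gt0// invr_gt0.
Unshelve. all: by end_near. Qed.

(** Intermediate value theorem for [h x - x] on [[0, h 0]]: at the right end, [h (h 0) <= h 0] by
    monotonicity. *)
Lemma exists_fixpoint (h : R -> R) (K : R) :
  (forall x, 0 <= h x) -> (forall x y, x <= y -> h y <= h x) ->
  (forall x y, `|h x - h y| <= K * `|x - y|) ->
  exists c, 0 <= c /\ h c - c = 0.
Proof.
move=> h0 hdec hK.
have cf : {within `[0, h 0], continuous (fun x => h x - x)}.
  apply: continuous_subspaceT => x.
  by apply: cvgB; [exact: (lipschitz_continuousT hK)|exact: cvg_id].
have fneg : h (h 0) - h 0 <= 0 by rewrite subr_le0 hdec.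
have fpos : 0 <= h 0 - 0 by rewrite subr0.
have [] := IVT (h0 0) cf (v := 0); first by rewrite ge_min fneg orbT le_max fpos.
by move=> c; rewrite in_itv/= => /andP[c0 _] hc; exists c.
Qed.

Section fixpoint.
Variables (h : R -> R) (c : R).
Hypothesis hdec : forall x y, x <= y -> h y <= h x.
Hypothesis hc : h c - c = 0.

(** Replaces a comparison with the implicitly defined root by one with the explicit [h];
    measurability of the root rests on this. *)
Lemma fixpoint_le x : (c <= x) = (h x <= x).
Proof.
apply/idP/idP => [cx|hx].
  by rewrite (le_trans _ cx)// -[X in _ <= X]addr0 -hc addrC subrK hdec.
rewrite leNgt; apply/negP => xc; by move: hc (hdec (ltW xc)) => ? ?; lra.
Qed.

Lemma fixpoint_dist x : `|c - x| <= `|h x - x|.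
Proof.
have [cx|/ltW xc] := leP c x.
  by move: hc (hdec cx) => ? ?; rewrite ler0_norm ?subr_le0// ler0_norm; lra.
by move: hc (hdec xc) => ? ?; rewrite ger0_norm ?subr_ge0// ger0_norm; lra.
Qed.

End fixpoint.

Lemma posp_lip (a b : R) : `|posp a - posp b| <= `|a - b|.
Proof.
have h1 := ler_norm (a - b); have h2 := ler_norm (b - a).
rewrite distrC in h2; rewrite /posp ler_norml.
by case: (leP a 0) => a0; case: (leP b 0) => b0; apply/andP; split; lra.
Qed.

Lemma posp_ge0 (a : R) : 0 <= posp a.
Proof. by rewrite /posp le_max lexx orbT. Qed.

Lemma le_posp (a b : R) : a <= b -> posp a <= posp b.
Proof. by move=> ab; rewrite /posp ge_max !le_max ab lexx orbT. Qed.

(** Each new term is at most the increment of the square root, since [a - b = 1 / (a + b)] when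
    [a ^+ 2 = b ^+ 2 + 1]. Equality at [n = 1] is the source of [2^-1]. *)
Lemma sum_half_invsqrt n : (0 < n)%N ->
  \sum_(i < n) (2 * Num.sqrt i.+1%:R)^-1 <= Num.sqrt n%:R - 2^-1 :> R.
Proof.
case: n => // n _; elim: n => [|n IH].
  by rewrite big_ord_recr big_ord0/= sqrtr1; lra.
rewrite big_ord_recr/=; apply: le_trans (lerD IH (lexx _)) _.
set b := Num.sqrt n.+1%:R; set a := Num.sqrt n.+2%:R.
have a0 : 0 < a by rewrite sqrtr_gt0 ltr0n.
have b0 : 0 <= b by exact: sqrtr_ge0.
have aE : a ^+ 2 = b ^+ 2 + 1 by rewrite !sqr_sqrtr ?ler0n// -natr1.
suff : (2 * a)^-1 <= a - b by lra.
rewrite -[X in X <= _]mul1r ler_pdivrMr ?mulr_gt0//; nra.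
Qed.

(** The worst case puts all the weight on the first indices. With the threshold [t = (2 * s)^-1],
    each term is at most [max (v n - t) 0 + p n * t]; the second parts add up to at most [s / 2],
    the first to at most [s / 2 - 1 / 2]. *)
Lemma weighted_sum_half_invsqrt (p : nat -> R) (M : R) K :
  (forall n, 0 <= p n <= 1) -> 1 <= M -> \sum_(n < K) p n <= M ->
  \sum_(n < K) p n * (2 * Num.sqrt n.+1%:R)^-1 <= Num.sqrt M - 2^-1.
Proof.
move=> p01 M1 pM; set s := Num.sqrt M.
have s1 : 1 <= s by rewrite -sqrtr1 ler_sqrt// (le_trans ler01).
have s0 : 0 < s by exact: lt_le_trans ltr01 s1.
have sE : s ^+ 2 = M by rewrite sqr_sqrtr// (le_trans ler01).
pose v n : R := (2 * Num.sqrt n.+1%:R)^-1.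
pose e n : R := v n - (2 * s)^-1.
have vdec m n : (m <= n)%N -> v n <= v m.
  move=> mn; rewrite /v lef_pV2 ?posrE ?mulr_gt0 ?sqrtr_gt0 ?ltr0n//.
  by rewrite ler_pM2l// ler_sqrt ?ler0n// ler_nat.
have esum k : \sum_(n < k) Num.max (e n) 0 <= s / 2 - 2^-1.
  elim: k => [|k IH]; first by rewrite big_ord0; lra.
  have [ek|ek] := leP (e k) 0.
    by rewrite big_ord_recr/= (max_r ek) addr0.
  rewrite (eq_bigr (fun n : 'I_k.+1 => v n - (2 * s)^-1)); last first.
    move=> i _; rewrite max_l// (le_trans (ltW ek))// lerB// vdec//.
    by rewrite -ltnS.
  rewrite sumrB sumr_const card_ord -[X in _ - X]mulr_natl.
  have := @sum_half_invsqrt k.+1 isT; rewrite -/(v _).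
  set q := Num.sqrt k.+1%:R => hq.
  have qE : k.+1%:R = q ^+ 2 by rewrite sqr_sqrtr ?ler0n.
  rewrite qE; apply: le_trans (lerB hq (lexx _)) _.
  (* This is the inequality of arithmetic and geometric means, from [(q - s) ^+ 2 >= 0]. *)
  suff : q <= s / 2 + q ^+ 2 / (2 * s) by lra.
  have -> : s / 2 + q ^+ 2 / (2 * s) = (s ^+ 2 + q ^+ 2) / (2 * s).
    by field; rewrite gt_eqF.
  rewrite ler_pdivlMr ?mulr_gt0//; have := sqr_ge0 (q - s); nra.
apply: (@le_trans _ _ (\sum_(n < K) (Num.max (e n) 0 + p n * (2 * s)^-1))).
  apply: ler_sum => n _; rewrite -/(v n) -lerBlDr -mulrBr -/(e n).
  have /andP[p0 p1] := p01 n.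
  by case: (leP (e n) 0) => en; nra.
rewrite big_split/= -mulr_suml.
have : (\sum_(n < K) p n) * (2 * s)^-1 <= s / 2.
  rewrite ler_pdivrMr ?mulr_gt0//; nra.
have := esum K; lra.
Qed.

Lemma sin_le (x : R) : 0 <= x -> sin x <= x.
Proof.
move=> x0.
have [c _] := @MVT_segment R sin cos 0 x x0 (fun y _ => is_derive_sin y)
  (continuous_subspaceT (@continuous_sin R)).
by rewrite sin0 !subr0 => ->; rewrite ler_piMl// cos_le1.
Qed.

(** From [cos (pi / 2) = 0] the square of [sin (pi / 4)] is 1/2, so [sin x <= x] gives
    [pi / 2 >= sqrt 2 > 4 / 3]. *)
Lemma pihalf_ge43 : 4 / 3 <= pi / 2 :> R.
Proof.
have p0 : 0 <= pi / 4 :> R by rewrite divr_ge0// pi_ge0.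
have := @cos_mulr2n R (pi / 4).
rewrite (_ : pi / 4 *+ 2 = pi / 2); last by rewrite -mulr_natr; field.
rewrite cos_pihalf cos2sin2 => h.
have s0 : 0 <= sin (pi / 4) :> R.
  by apply: sin_ge0_pi; rewrite p0/= ler_pdivrMr// ler_peMr ?pi_ge0// ler1n.
have sp := sin_le p0.
have : (2^-1 : R) <= (pi / 4) ^+ 2.
  have : sin (pi / 4) ^+ 2 <= (pi / 4 : R) ^+ 2 by rewrite ler_sqr ?nnegrE.
  rewrite -mulr_natr in h; lra.
rewrite leNgt => h2; rewrite leNgt; apply/negP => h3; nra.
Qed.

(** If [a > q + 1 / 2], squaring and [a ^+ 2 <= q ^+ 2 + 4 / 3] give [q < 13 / 12], whereas
    [q ^+ 2 >= 4 / 3]. *)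
Lemma sqrt_horizon_bound (t : R) : 0 <= t ->
  Num.sqrt (4 / 3 * (t + 2)) - 2^-1 <= Num.sqrt (pi / 2) * Num.sqrt (t + 1).
Proof.
move=> t0; rewrite -sqrtrM; last by rewrite divr_ge0// pi_ge0.
set a := Num.sqrt _; set q := Num.sqrt _.
have a0 : 0 <= a by exact: sqrtr_ge0.
have q0 : 0 <= q by exact: sqrtr_ge0.
have p43 := pihalf_ge43.
have aE : a ^+ 2 = 4 / 3 * (t + 2) by rewrite sqr_sqrtr//; lra.
have qE : 4 / 3 * (t + 1) <= q ^+ 2.
  by rewrite sqr_sqrtr; [rewrite ler_pM2r//; lra|rewrite mulr_ge0//; lra].
rewrite leNgt; apply/negP => aq.
have : q ^+ 2 + q + 4^-1 < a ^+ 2 by nra.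
rewrite aE => h; have q1 : q < 13 / 12 by lra.
nra.
Qed.

End real_lemmas.

(** * Truncated means of an exponential variable *)

Section exponential.
Context {d : measure_display} {Omega : measurableType d} {R : realType}.
Context (P : probability Omega R).
Local Notation Ex f := (Rintegral P setT f).

Variables (lam b : R) (S : Omega -> R).
Hypotheses (lam0 : 0 < lam) (b0 : 0 < b) (mS : measurable_fun setT S).
Hypothesis S0 : forall w, 0 <= S w.
Hypothesis SE : forall B : set R, measurable B ->
  P (S @^-1` B) = exponential_prob lam B.

Lemma exponential_tail r : 0 <= r -> P [set w | r < S w] = (expR (- lam * r))%:E.
Proof.
move=> r0.
have mle : measurable [set w | S w <= r].
  rewrite -[X in measurable X]setTI.
  rewrite (_ : [set w | _] = S @^-1` `]-oo, r]); first exact: mS.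
  by apply/seteqP; split=> w; rewrite /= in_itv.
have -> : [set w | r < S w] = ~` [set w | S w <= r].
  by apply/seteqP; split=> w /=; rewrite ltNge => /negP.
have -> : P (~` [set w | S w <= r]) = (1 - P [set w | (S w <= r)%R])%E.
  exact: probability_setC.
have -> : [set w | S w <= r] = S @^-1` `[0, r].
  by apply/seteqP; split=> w; rewrite /= in_itv/= S0.
rewrite SE//; have [->|rn0] := eqVneq r 0.
  by rewrite set_itv1 /exponential_prob integral_set1 mulr0 expR0 sube0.
have {rn0}r0 : 0 < r by rewrite lt_neqAle eq_sym rn0.
rewrite exponential_prob_itv0c//.
by rewrite -[LHS]/((1 - (1 - expR (- lam * r)))%:E) subKr.
Qed.

(** The mean is the integral of the tail. Below [b] the tail is [expR (- lam * r)], which is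
    [lam^-1] times the exponential density; from [b] on it is zero. *)
Lemma Ex_min_exponential :
  Ex (fun w => Num.min (S w) b) = (1 - expR (- lam * b)) / lam.
Proof.
have mmin : measurable_fun setT (fun w => Num.min (S w) b) by exact: measurable_minr.
pose F : {mfun Omega >-> R} :=
  HB.pack (fun w => Num.min (S w) b) (isMeasurableFun.Build _ _ _ _ _ mmin).
have F0 w : 0 <= F w by rewrite /= le_min S0 ltW.
have := @ge0_expectation_ccdf _ _ _ P F F0; rewrite unlock /= /Rintegral => ->.
pose g (r : R) := (lam^-1 * exponential_pdf lam r)%:E.
have mg : measurable_fun setT g.
  apply/measurable_EFinP; apply: measurable_funM => //.
  exact: measurable_exponential_pdf.
have -> : (\int[lebesgue_measure]_(r in `[0%R, +oo[) ccdf (F : {RV P >-> R}) r =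
    \int[lebesgue_measure]_(r in `[0%R, b[) g r)%E.
  have -> : `[0, b[%classic = `[0, +oo[%classic `&` `]-oo, b[%classic.
    by apply/seteqP; split=> x /=; rewrite !in_itv/= andbT => /andP.
  rewrite integral_mkcondr; apply: eq_integral => r.
  rewrite inE/= in_itv/= andbT => r0; rewrite patchE /ccdf /distribution /pushforward.
  have -> : F @^-1` `]r, +oo[ = if r < b then [set w | r < S w] else set0.
    case: ifPn => rb; apply/seteqP; split=> w //=;
      by rewrite in_itv/= andbT lt_min ?rb ?andbT ?(negbTE rb) ?andbF.
  case: ifPn => rb.
    rewrite mem_set/= ?in_itv//= exponential_tail// /g exponential_pdfE//.
    by rewrite mulrA mulVf ?mul1r// gt_eqF.
  by rewrite memNset/= ?in_itv/= ?measure0//; exact/negP.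
rewrite integral_itv_bndo_bndc; last exact: measurable_funS mg.
under eq_integral do rewrite /g EFinM.
rewrite ge0_integralZl//; last 3 first.
- apply/measurable_EFinP; apply: measurable_funS (measurable_exponential_pdf lam) => //.
- by move=> x _; rewrite lee_fin exponential_pdf_ge0// ltW.
- by rewrite lee_fin invr_ge0 ltW.
rewrite -/(exponential_prob lam `[0, b]) exponential_prob_itv0c//.
by rewrite -[LHS]/(lam^-1 * (1 - expR (- lam * b))) mulrC.
Qed.

Lemma Ex_min_exponential_le : Ex (fun w => Num.min (S w) b) <= lam^-1.
Proof.
by rewrite Ex_min_exponential -[leRHS]mul1r ler_pM2r ?invr_gt0// gerBl expR_ge0.
Qed.

(** The mean is [(1 - expR (- 2)) / lam], and [expR 2 >= 4] since [expR 1 >= 2]. *)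
Lemma Ex_min_exponential_ge : b = 2 / lam ->
  3 / 4 / lam <= Ex (fun w => Num.min (S w) b).
Proof.
rewrite Ex_min_exponential => ->; rewrite ler_pM2r ?invr_gt0//.
have -> : - lam * (2 / lam) = - 2 by field; rewrite gt_eqF.
have e1 : 2 <= expR 1 :> R by have := @expR_ge1Dx R 1; lra.
have e2 : 4 <= expR 2 :> R.
  by rewrite -[2 in leRHS]mulr1 expRM_natl expr2; nra.
rewrite expRN; have : (expR 2)^-1 <= 4^-1 :> R by rewrite lef_pV2 ?posrE ?expR_gt0.
lra.
Qed.

End exponential.

(** * The policy: its roots, decisions and dependence on the past *)

Section policy.
Context {d : measure_display} {Omega : measurableType d} {R : realType}.
Context (P : probability Omega R).
Local Notation Ex f := (Rintegral P setT f).
Variables (C lam E D T : R) (r : R -> R) (X S : nat -> Omega -> R).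
Hypotheses (C0 : 0 < C) (lam0 : 0 < lam) (E0 : E <= 0) (D0 : 0 <= D).
Hypothesis rED : forall x, 0 <= x <= C -> E <= r x <= D.
Hypothesis mr : measurable_fun `[0, C] r.
Hypothesis mX : forall n, measurable_fun setT (X n).
Hypothesis mS : forall n, measurable_fun setT (S n).
Hypothesis X0C : forall n w, 0 <= X n w <= C.

Local Notation a n w := (alg_a lam r X n w).
Local Notation c n w := (alg_c lam r X n w).

(** A single family, so that one independence hypothesis covers durations and idle times jointly. *)
Definition coords (i : nat + nat) := match i with inl n => X n | inr n => S n end.
Definition past (n : nat) : set (nat + nat) :=
  [set i | match i with inl m => (m < n)%N | inr m => (m < n)%N end].

Lemma measurable_coords i : measurable_fun setT (coords i).
Proof. by case: i. Qed.

(** This is Phi_n(x) + x, so that [alg_c] is its fixed point. *)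
Definition empirical (n : nat) (w : Omega) (x : R) :=
  lam * (n.+1%:R^-1 * \sum_(i < n.+1) posp (r (X i w) - x * X i w)).

Lemma empirical_ge0 n w x : 0 <= empirical n w x.
Proof.
rewrite /empirical mulr_ge0 ?(ltW lam0)// mulr_ge0// sumr_ge0// => i _.
exact: posp_ge0.
Qed.

Lemma empirical_le n w x y : x <= y -> empirical n w y <= empirical n w x.
Proof.
move=> xy; rewrite /empirical ler_pM2l// ler_pM2l ?invr_gt0 ?ltr0n//.
apply: ler_sum => i _; apply: le_posp.
by rewrite lerB// ler_wpM2r//; have /andP[] := X0C i w.
Qed.

Lemma posp_gain_lip x y u v : 0 <= u <= C ->
  `|posp (v - x * u) - posp (v - y * u)| <= C * `|x - y|.
Proof.
move=> /andP[u0 uC]; rewrite (le_trans (posp_lip _ _))//.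
have -> : v - x * u - (v - y * u) = (y - x) * u by ring.
by rewrite normrM distrC mulrC (ger0_norm u0) ler_wpM2r.
Qed.

Lemma empirical_lip n w x y :
  `|empirical n w x - empirical n w y| <= lam * C * `|x - y|.
Proof.
rewrite /empirical -!mulrBr normrM (gtr0_norm lam0) -mulrA ler_pM2l//.
rewrite -sumrB normrM gtr0_norm ?invr_gt0 ?ltr0n// ler_pdivrMl ?ltr0n//.
rewrite (le_trans (ler_norm_sum _ _ _))//.
rewrite mulr_natl -[in leRHS](card_ord n.+1) -sumr_const.
by apply: ler_sum => i _; exact: posp_gain_lip.
Qed.

(** A root exists, so [xget] never returns its default. *)
Lemma alg_cP n w : 0 <= c n w /\ empirical n w (c n w) - c n w = 0.
Proof.
have [x xP] := @exists_fixpoint R (empirical n w) (lam * C)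
  (empirical_ge0 n w) (@empirical_le n w) (@empirical_lip n w).
by rewrite /alg_c; case: xgetP => [y -> //|/(_ x) []].
Qed.

Lemma alg_c_le n w x : (c n w <= x) = (empirical n w x <= x).
Proof. by have [_ h] := alg_cP n w; apply: fixpoint_le h _; exact: empirical_le. Qed.

Lemma alg_c_dist n w x : `|c n w - x| <= `|empirical n w x - x|.
Proof. by have [_ h] := alg_cP n w; apply: fixpoint_dist h _; exact: empirical_le. Qed.

Lemma alg_a01 n w : 0 <= a n w <= 1.
Proof. by rewrite /alg_a; case: ifP; rewrite lexx ler01. Qed.

Lemma reward_norm_le n w : `|r (X n w) * a n w| <= D - E.
Proof.
have /andP[h1 h2] := rED (X0C n w); move: E0 D0 => ? ?.
by rewrite ler_norml /alg_a; case: ifP => _; apply/andP; split; lra.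
Qed.

Section sub_measurability.
Local Notation sub_meas J f := (sub_measurable coords J f).

Lemma sub_measurable_X (J : set (nat + nat)) n : J (inl n) -> sub_meas J (X n).
Proof. exact: (@sub_measurable_coord _ _ _ _ coords). Qed.

Lemma sub_measurable_S (J : set (nat + nat)) n : J (inr n) -> sub_meas J (S n).
Proof. exact: (@sub_measurable_coord _ _ _ _ coords J (inr n)). Qed.

Lemma sub_measurable_rX (J : set (nat + nat)) n :
  J (inl n) -> sub_meas J (fun w => r (X n w)).
Proof.
move=> Jn; apply: (@measurable_comp _ _ _ _ _ _ `[0, C]%classic r) => //.
- by move=> _ [w _ <-]; rewrite /= in_itv/=.
- exact: sub_measurable_X.
Qed.

Lemma sub_measurable_gain (J : set (nat + nat)) n x :
  J (inl n) -> sub_meas J (fun w => posp (r (X n w) - x * X n w)).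
Proof.
move=> Jn; apply: measurable_maxr => //.
apply: measurable_funB; first exact: sub_measurable_rX.
by apply: measurable_funM => //; exact: sub_measurable_X.
Qed.

Lemma sub_measurable_empirical n x :
  sub_meas (past n.+1) (fun w => empirical n w x).
Proof.
apply: measurable_funM => //; apply: measurable_funM => //.
by apply: measurable_sum => i; apply: sub_measurable_gain => /=.
Qed.

(** On the generating rays with [x >= 0], monotonicity turns the event [c n w > x] into
    [empirical n w x > x], which involves no choice of a root. *)
Lemma sub_measurable_alg_c n : sub_meas (past n.+1) (fun w => c n w).
Proof.
move=> mT; apply: (measurability _ (RGenOInfty.measurableE R)) => //.
move=> /= _ [_ [x ->] <-]; rewrite setTI.
have [x0|x0] := ltP x 0.
  rewrite (_ : _ @^-1` _ = setT)//; apply/seteqP; split=> // w _ /=.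
  by rewrite in_itv/= andbT (lt_le_trans x0)//; case: (alg_cP n w).
rewrite (_ : _ @^-1` _ = (fun w => empirical n w x) @^-1` `]x, +oo[%classic).
  by have := @sub_measurable_empirical n x measurableT _ (measurable_itv `]x, +oo[); rewrite setTI.
by apply/seteqP; split=> w; rewrite /= !in_itv/= !andbT !ltNge alg_c_le.
Qed.

Lemma sub_measurable_alg_a n : sub_meas (past n.+1) (fun w => a n w).
Proof.
apply: measurable_fun_ifT => //; apply: measurable_fun_ler.
- apply: measurable_funM; first exact: sub_measurable_alg_c.
  by apply: sub_measurable_X => /=.
- by apply: sub_measurable_rX => /=.
Qed.

Lemma past_mono m n : (m <= n)%N -> past m `<=` past n.
Proof. by move=> mn [] k /= km; exact: leq_trans km mn. Qed.

Lemma sub_measurable_elapsed n :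
  sub_meas (past n.+1) (fun w => elapsed lam r X S n w).
Proof.
apply: measurable_sum => i.
apply: measurable_funD; first by apply: sub_measurable_S => /=.
apply: measurable_funM; first by apply: sub_measurable_X => /=.
exact: (sub_measurable_mono (past_mono (ltn_ord i)) (@sub_measurable_alg_a i)).
Qed.

(** The strict [m < n] keeps the event in the past of step [n]. It serves for the elapsed time and
    for the truncated idle times. *)
Definition below (F : nat -> Omega -> R) (n : nat) :=
  [set w | forall m, (m < n)%N -> F m w <= T].

Lemma sub_measurable_below (J : set (nat + nat)) (F : nat -> Omega -> R) n :
  (forall m, (m < n)%N -> sub_meas J (F m)) -> <<s cylinders coords J >> (below F n).
Proof.
move=> mF; rewrite (_ : below F n =
    \bigcap_m (if (m < n)%N then F m @^-1` `]-oo, T] else setT)).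
  apply: (@bigcapT_measurable _ (g_sigma_algebraType (cylinders coords J))) => m.
  case: ifPn => [mn|_]; last exact: measurableT.
  by have := mF _ mn measurableT _ (measurable_itv `]-oo, T]); rewrite setTI.
apply/seteqP; split=> w /= h m.
  by move=> _; case: ifPn => // mn; rewrite /= in_itv/= h.
by move=> mn; have := h m I; rewrite mn /= in_itv.
Qed.

End sub_measurability.

(** The event [n <= theta]: the task of index [n] is proposed before the horizon. *)
Definition active := below (elapsed lam r X S).

(** This makes [active n] independent of the duration and idle time of step [n], as Wald's identity
    requires. *)
Lemma sub_measurable_active n : <<s cylinders coords (past n) >> (active n).
Proof.
apply: sub_measurable_below => m mn.
exact: (sub_measurable_mono (past_mono mn) (@sub_measurable_elapsed m)).
Qed.

Lemma measurable_active n : measurable (active n).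
Proof.
exact: (sigma_cylinder_measurable measurable_coords (@sub_measurable_active n)).
Qed.

Lemma below_mono F m n : (m <= n)%N -> below F n `<=` below F m.
Proof. by move=> mn w h k km; apply: h; exact: leq_trans km mn. Qed.

(** * The total reward as a limit of bounded sums *)

Lemma measurable_reward n : measurable_fun setT (fun w => r (X n w) * a n w).
Proof.
apply: measurable_funM.
  by apply: (sub_measurableW measurable_coords (J := [set inl n])); exact: sub_measurable_rX.
exact: (sub_measurableW measurable_coords (@sub_measurable_alg_a n)).
Qed.

(** The random upper limit [theta] is encoded by indicators, which leaves a bounded sum with a fixed
    number of terms. *)
Definition reward_upto (K : nat) (w : Omega) :=
  \sum_(n < K) r (X n w) * a n w * \1_(active n) w.

Lemma bmf_reward n : bounded_measurable (fun w => r (X n w) * a n w).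
Proof. by split; [exact: measurable_reward|exists (D - E); exact: reward_norm_le]. Qed.

Lemma bmf_reward_upto K : bounded_measurable (reward_upto K).
Proof.
apply: (@bmf_sum _ _ _ K (fun n w => r (X n w) * a n w * \1_(active n) w)) => n.
by apply: bmfM; [exact: bmf_reward|apply: bmf_indic; exact: measurable_active].
Qed.

Lemma reward_upto_cvg w : ~ (\bigcap_n active n) w ->
  (reward_upto ^~ w) n @[n --> \oo] --> total_reward lam T r X S w.
Proof.
move=> nA; rewrite /total_reward /theta; case: xgetP => [t _ [tT tle]|noroot]; last first.
  (* Any passage of the horizon has a least index, and that index would qualify as [theta]. *)
  exfalso; apply: nA => n _ m _; rewrite leNgt; apply/negP => Tm.
  have exT : exists k, T < elapsed lam r X S k w by exists m.
  have := noroot (ex_minn exT); apply; case: ex_minnP => k Tk kmin; split=> // l lk.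
  by rewrite leNgt; apply/negP => /kmin; rewrite leqNgt lk.
apply: cvg_near_cst; exists t.+1 => // K /= tK; rewrite /reward_upto.
rewrite (bigID (fun n : 'I_K => (n < t.+1)%N))/= [X in _ + X]big1 ?addr0; last first.
  move=> i; rewrite -leqNgt => ti; rewrite indicE memNset ?mulr0//= => /(_ t ti).
  by rewrite leNgt tT.
rewrite -(big_ord_widen_cond _ (fun=> true) (fun n => r (X n w) * a n w * \1_(active n) w) tK).
apply: eq_bigr => i _; rewrite indicE mem_set ?mulr1//= => m mi.
by apply: tle; rewrite (leq_trans mi)// -ltnS.
Qed.

Lemma measurable_total_reward : measurable_fun setT (total_reward lam T r X S).
Proof.
(* If the horizon is never passed, [theta] takes its default [0] and the total reward is that of
   step 0. Using this value while [active K] holds makes [V] converge everywhere. *)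
pose V K w := if w \in active K then r (X 0%N w) * a 0%N w else reward_upto K w.
apply: (@measurable_fun_cvg _ _ _ _ V).
- move=> K; apply: measurable_fun_ifT.
  + apply: (measurable_fun_bool true) => //; rewrite setTI.
    rewrite (_ : _ @^-1` _ = active K); first exact: measurable_active.
    by apply/seteqP; split=> w /=; [exact: set_mem|exact: mem_set].
  + exact: measurable_reward.
  + by have [] := bmf_reward_upto K.
- move=> w _; have [allA|nA] := pselect ((\bigcap_n active n) w).
    rewrite /total_reward /theta xgetPN; last first.
      by move=> n [Tn _]; have /(_ n (ltnSn n)) := allA n.+1 I; rewrite leNgt Tn.
    rewrite big_ord1; apply: cvg_near_cst; near=> K.
    by rewrite /V mem_set//; exact: allA.
  have [n nAn] : exists n, ~ active n w.
    by apply/existsNP => allA; apply: nA => n _.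
  apply: cvg_trans (reward_upto_cvg nA); apply: near_eq_cvg.
  exists n => // K /= nK; rewrite /V memNset// => AK.
  by apply: nAn; exact: below_mono AK.
Unshelve. all: by end_near. Qed.

Lemma bmf_gain n x : bounded_measurable (fun w => posp (r (X n w) - x * X n w)).
Proof.
split.
  apply: (sub_measurableW measurable_coords (J := [set inl n])).
  exact: sub_measurable_gain.
exists (D - E + `|x| * C) => w; have /andP[X0 XC] := X0C n w.
have := posp_lip (r (X n w) - x * X n w) 0.
rewrite [posp 0]max_l// !subr0 => /le_trans; apply.
rewrite (le_trans (ler_normB _ _))// lerD//.
  have /andP[h1 h2] := rED (X0C n w); move: E0 D0 => ? ?.
  by rewrite ler_norml; apply/andP; split; lra.
by rewrite normrM ler_wpM2l// ger0_norm.
Qed.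

Local Notation cs := (cstar P lam r (X 0%N)).
Local Notation mu := (Ex (fun w => posp (r (X 0%N w) - cs * X 0%N w))).

(** The fixed-point argument again: monotonicity and the Lipschitz constant [lam * C] pass through
    the expectation. *)
Lemma cstarP : 0 <= cs /\ lam * mu - cs = 0.
Proof.
pose h x := lam * Ex (fun w => posp (r (X 0%N w) - x * X 0%N w)).
have h0 x : 0 <= h x.
  by rewrite mulr_ge0 ?(ltW lam0)// Ex_ge0// => w; exact: posp_ge0.
have hdec x y : x <= y -> h y <= h x.
  move=> xy; rewrite ler_pM2l//; apply: Ex_le; [exact: bmf_gain..|] => w.
  by apply: le_posp; rewrite lerB// ler_wpM2r//; have /andP[] := X0C 0%N w.
have hlip x y : `|h x - h y| <= lam * C * `|x - y|.
  rewrite -mulrBr normrM (gtr0_norm lam0) -mulrA ler_pM2l//.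
  rewrite -ExB; [|exact: bmf_gain..].
  have bB : bounded_measurable (fun w => posp (r (X 0%N w) - x * X 0%N w) -
    posp (r (X 0%N w) - y * X 0%N w)) by apply: bmfB; exact: bmf_gain.
  rewrite (le_trans (le_normr_Rintegral _ (bmf_integrable P bB)))//.
  rewrite -[leRHS](Ex_cst P); apply: Ex_le; [exact: bmf_norm|exact: bmf_cst|] => w.
  exact: posp_gain_lip.
have [x xP] := exists_fixpoint h0 hdec hlip.
rewrite /cstar; case: xgetP => [y _ [y0 yP]|/(_ x)[]].
  by split => //; rewrite -yP unlock.
by rewrite /h in xP; rewrite /= unlock.
Qed.

Hypotheses (T0 : 0 < T) (S0 : forall n w, 0 <= S n w).
Hypothesis lawX : forall n (B : set R), measurable B ->
  P (X n @^-1` B) = P (X 0%N @^-1` B).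
Hypothesis lawS : forall n (B : set R), measurable B ->
  P (S n @^-1` B) = exponential_prob lam B.
Hypothesis indep : mutually_independent P coords.

(** * Deviations of the empirical mean gain *)

Definition gain n w := posp (r (X n w) - cs * X n w).

Lemma gain_0D n w : 0 <= gain n w <= D.
Proof.
rewrite posp_ge0/= /gain /posp ge_max D0 andbT.
have /andP[_ rD] := rED (X0C n w); have /andP[X0 _] := X0C n w.
by rewrite (le_trans _ rD)// gerBl mulr_ge0//; case: cstarP.
Qed.

Lemma bmf_gaincs n : bounded_measurable (gain n).
Proof. exact: bmf_gain. Qed.

Lemma Ex_gain n : Ex (gain n) = mu.
Proof.
apply: (@ge0_Ex_same_law _ _ _ _ (fun x => posp (r x - cs * x)) `[0, C]%classic
  (X n) (X 0%N)) => //.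
- apply: measurable_maxr => //; apply: measurable_funB => //.
- by move=> x _; exact: posp_ge0.
- by move=> w /=; rewrite in_itv/=.
- by move=> w /=; rewrite in_itv/=.
- exact: lawX.
Qed.

Definition deviation n w := \sum_(i < n) (gain i w - mu).

Lemma bmf_centered n : bounded_measurable (fun w => gain n w - mu).
Proof. by apply: bmfB; [exact: bmf_gaincs|exact: bmf_cst]. Qed.

Lemma bmf_deviation n : bounded_measurable (deviation n).
Proof. exact: (@bmf_sum _ _ _ n (fun i w => gain i w - mu) bmf_centered). Qed.

Lemma sub_measurable_centered (J : set (nat + nat)) n :
  J (inl n) -> sub_measurable coords J (fun w => gain n w - mu).
Proof. by move=> Jn; apply: measurable_funB => //; exact: sub_measurable_gain. Qed.

Lemma sub_measurable_deviation (J : set (nat + nat)) n :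
  (forall i, (i < n)%N -> J (inl i)) -> sub_measurable coords J (deviation n).
Proof.
by move=> Jn; apply: measurable_sum => i; apply: sub_measurable_centered; exact: Jn.
Qed.

Lemma Ex_centered n : Ex (fun w => gain n w - mu) = 0.
Proof. by rewrite ExB ?Ex_gain ?Ex_cst ?subrr//; [exact: bmf_gaincs|exact: bmf_cst]. Qed.

(** A gain [g] in [[0, D]] satisfies [g ^+ 2 <= D * g], so its variance is at most
    [mu * (D - mu)]. *)
Lemma variance_gain n : Ex (fun w => (gain n w - mu) * (gain n w - mu)) <= D ^+ 2 / 4.
Proof.
have bg := bmf_gaincs n.
apply: (@le_trans _ _ (Ex (fun w => (D - 2 * mu) * gain n w + mu ^+ 2))).
  apply: Ex_le => [||w].
  - by apply: bmfM; exact: bmf_centered.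
  - by apply: bmfD; [exact: bmfZ|exact: bmf_cst].
  - by have /andP[g0 gD] := gain_0D n w; nra.
rewrite ExD; [|exact: bmfZ|exact: bmf_cst]; rewrite ExZ// Ex_gain Ex_cst.
by have := sqr_ge0 (mu - D / 2); nra.
Qed.

(** Variances add: in each cross term the next gain is centered and independent of the earlier
    ones. *)
Lemma Ex_deviation_sq n : Ex (fun w => deviation n w * deviation n w) <= n%:R * (D ^+ 2 / 4).
Proof.
elim: n => [|n IH].
  rewrite mul0r (_ : (fun w => _) = fun=> 0) ?Ex_cst//.
  by apply/funext => w; rewrite /deviation big_ord0 mul0r.
have bV := bmf_deviation n; have bc := bmf_centered n.
have -> : (fun w => deviation n.+1 w * deviation n.+1 w) = (fun w =>
    deviation n w * deviation n w + (2 * (deviation n w * (gain n w - mu)) +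
    (gain n w - mu) * (gain n w - mu))).
  by apply/funext => w; rewrite /deviation big_ord_recr/=; ring.
rewrite ExD; [|exact: bmfM|by apply: bmfD; [apply: bmfZ|]; exact: bmfM].
rewrite ExD; [|by apply: bmfZ; exact: bmfM|exact: bmfM].
rewrite ExZ; last exact: bmfM.
rewrite (@Ex_prod_indep _ _ _ P _ _ measurable_coords indep
    [set i | if i is inl m then (m < n)%N else false] [set inl n]
    (deviation n) (fun w => gain n w - mu))//.
- rewrite Ex_centered mulr0 mulr0 add0r -natr1 mulrDl mul1r lerD//.
  exact: variance_gain.
- by apply/seteqP; split=> // -[m|m] [//= mn []]// => mE; rewrite mE ltnn in mn.
- exact: sub_measurable_deviation.
- exact: sub_measurable_centered.
Qed.

(** The variance of the absolute deviation is nonnegative, so its squared mean [e ^+ 2] is at most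
    the second moment. *)
Lemma Ex_deviation_abs n : Ex (fun w => `|deviation n w|) <= Num.sqrt n%:R * (D / 2).
Proof.
have bV := bmf_deviation n; have ba := bmf_norm bV.
set e := Ex _.
have e0 : 0 <= e by apply: Ex_ge0.
have : 0 <= Ex (fun w => (`|deviation n w| - e) * (`|deviation n w| - e)).
  by apply: Ex_ge0 => w; rewrite -expr2 sqr_ge0.
rewrite (_ : (fun w => _) = (fun w => deviation n w * deviation n w +
    ((- 2 * e) * `|deviation n w| + e ^+ 2))); last first.
  apply/funext => w; have : `|deviation n w| ^+ 2 = deviation n w ^+ 2.
    by rewrite real_normK// num_real.
  rewrite -!expr2 => <-; ring.
rewrite ExD; [|exact: bmfM|by apply: bmfD; [exact: bmfZ|exact: bmf_cst]].
rewrite ExD; [|exact: bmfZ|exact: bmf_cst].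
rewrite ExZ// -/e Ex_cst => h; have h2 := Ex_deviation_sq n.
have q0 : 0 <= Num.sqrt n%:R :> R by exact: sqrtr_ge0.
have qE : Num.sqrt n%:R ^+ 2 = n%:R :> R by rewrite sqr_sqrtr// ler0n.
rewrite -qE in h2.
rewrite -ler_sqr ?nnegrE//; last by rewrite mulr_ge0// divr_ge0.
by lra.
Qed.

(** A decision that differs from the one made with [cs] requires [r (X n w)] to lie between
    [cs * X n w] and [c n w * X n w], and so costs at most [C] times the distance of the two
    roots. *)
Lemma regret_step_le n w :
  gain n w - (r (X n w) - cs * X n w) * a n w <=
  lam * C * (n.+1%:R^-1 * `|deviation n.+1 w|).
Proof.
have /andP[X0 XC] := X0C n w; have [cs0 csE] := cstarP.
apply: (@le_trans _ _ (`|c n w - cs| * C)).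
  apply: (@le_trans _ _ (`|c n w - cs| * X n w)); last by rewrite ler_wpM2l.
  have h1 := ler_norm (c n w - cs); have h2 := ler_norm (cs - c n w).
  rewrite distrC in h2; move: `|_| h1 h2 => N h1 h2.
  have N0 : 0 <= N by lra.
  rewrite /gain /posp /alg_a; case: ifPn => [acc|]; last rewrite -ltNge => rej.
    by rewrite mulr1; case: (leP (r (X n w) - cs * X n w) 0) => h; nra.
  by rewrite mulr0 subr0; case: (leP (r (X n w) - cs * X n w) 0) => h; nra.
rewrite mulrC -mulrA mulrCA ler_pM2l// (le_trans (alg_c_dist _ _ _))//.
(* Writing the subtracted root as [lam * mu] exhibits an average of centered gains. *)
rewrite -[X in `|_ - X|](_ : lam * mu = _); last by move: csE; lra.
rewrite /empirical -mulrBr normrM (gtr0_norm lam0) ler_pM2l//.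
rewrite /deviation sumrB sumr_const card_ord -[X in _ <= _ * `|_ - X|]mulr_natl.
rewrite -[X in X * `|_|](@gtr0_norm _ n.+1%:R^-1) ?invr_gt0 ?ltr0n// -normrM.
by rewrite mulrBr mulKf ?pnatr_eq0.
Qed.

Lemma sub_measurable_indic (J : set (nat + nat)) A :
  <<s cylinders coords J >> A -> sub_measurable coords J (\1_A : Omega -> R).
Proof. by move=> sA; apply: measurable_indic. Qed.

(** * Bounding the expected number of proposals *)

Local Notation b := (2 / lam).

(** Truncating the idle times replaces the computation of the law of
    [S 0 + ... + S n] by Wald's identity with a bounded overshoot. *)
Definition waiting := below (fun n w => \sum_(i < n.+1) Num.min (S i w) b).

Lemma sub_measurable_minS (J : set (nat + nat)) n x :
  J (inr n) -> sub_measurable coords J (fun w => Num.min (S n w) x).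
Proof. by move=> Jn; apply: measurable_minr => //; exact: sub_measurable_S. Qed.

Lemma bmf_minS n x : 0 < x -> bounded_measurable (fun w => Num.min (S n w) x).
Proof.
move=> x0; split; first exact: measurable_minr.
by exists x => w; rewrite ger0_norm ?ge_min ?lexx ?orbT// le_min S0 ltW.
Qed.

Lemma sub_measurable_waiting (J : set (nat + nat)) n :
  (forall i, (i < n)%N -> J (inr i)) -> <<s cylinders coords J >> (waiting n).
Proof.
move=> Jn; apply: sub_measurable_below => m mn.
apply: measurable_sum => i; apply: sub_measurable_minS; apply: Jn.
exact: leq_trans (ltn_ord i) mn.
Qed.

Lemma measurable_waiting n : measurable (waiting n).
Proof.
apply: (sigma_cylinder_measurable measurable_coords (J := setT)).
exact: sub_measurable_waiting.
Qed.

(** Busy times are nonnegative and truncation shortens idle times, so the truncated clock never runs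
    ahead of the elapsed time. *)
Lemma active_waiting n : active n `<=` waiting n.
Proof.
move=> w h m mn; apply: le_trans (h m mn); apply: ler_sum => i _.
rewrite (le_trans (_ : _ <= S i w)) ?ge_min ?lexx// lerDl mulr_ge0//.
  by have /andP[] := X0C i w.
by have /andP[] := alg_a01 i w.
Qed.

Lemma bmf_active n : bounded_measurable (\1_(active n) : Omega -> R).
Proof. by apply: bmf_indic; exact: measurable_active. Qed.

Lemma bmf_waiting n : bounded_measurable (\1_(waiting n) : Omega -> R).
Proof. by apply: bmf_indic; exact: measurable_waiting. Qed.

Lemma indic01 (A : set Omega) w : 0 <= (\1_A w : R) <= 1.
Proof. by rewrite indicE; case: (_ \in _); rewrite lexx ler01. Qed.

Lemma Ex_waiting01 n : 0 <= Ex (\1_(waiting n)) <= 1.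
Proof.
apply/andP; split; first by apply: Ex_ge0 => w; case/andP: (indic01 (waiting n) w).
rewrite -[leRHS](Ex_cst P); apply: Ex_le => [||w].
- exact: bmf_waiting.
- exact: bmf_cst.
- by case/andP: (indic01 (waiting n) w).
Qed.

(** Before the last step that counts, the truncated clock is at most [T]; that step adds at most
    [b]. *)
Lemma sum_waiting_le K w :
  \sum_(n < K) Num.min (S n w) b * \1_(waiting n) w <= T + b.
Proof.
have b0 : 0 < b by rewrite divr_gt0.
elim: K => [|K IH]; first by rewrite big_ord0 addr_ge0// ltW.
rewrite big_ord_recr/= [in X in _ + X]indicE.
have [wK|wK] := boolP (w \in waiting K); last by rewrite mulr0 addr0.
move/set_mem : wK => wK; rewrite mulr1 lerD ?ge_min ?lexx ?orbT//.
rewrite (eq_bigr (fun n : 'I_K => Num.min (S n w) b)); last first.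
  move=> i _; rewrite indicE mem_set ?mulr1//.
  exact: below_mono (ltnW (ltn_ord i)) _ wK.
by case: K wK {IH} => [|K] wK; [rewrite big_ord0 ltW|exact: wK].
Qed.

(** Wald's identity: [waiting n] is independent of [S n], so each index costs on average at least
    [3 / 4 / lam] out of a budget of [T + 2 / lam]. *)
Lemma sum_Ex_waiting K :
  \sum_(n < K) Ex (\1_(waiting n)) <= 4 / 3 * (lam * T + 2).
Proof.
have b0 : 0 < b by rewrite divr_gt0.
have bF n : bounded_measurable (fun w => Num.min (S n w) b * \1_(waiting n) w).
  by apply: bmfM; [exact: bmf_minS|exact: bmf_waiting].
have : Ex (fun w => \sum_(n < K) Num.min (S n w) b * \1_(waiting n) w) <= T + b.
  rewrite -[leRHS](Ex_cst P); apply: Ex_le => [||w].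
  - exact: (@bmf_sum _ _ _ K (fun n w => Num.min (S n w) b * \1_(waiting n) w)).
  - exact: bmf_cst.
  - exact: sum_waiting_le.
rewrite (@Ex_sum _ _ _ P K (fun n w => Num.min (S n w) b * \1_(waiting n) w))// => h.
have : 3 / 4 / lam * \sum_(n < K) Ex (\1_(waiting n)) <= T + b.
  apply: le_trans h; rewrite mulr_sumr; apply: ler_sum => n _.
  rewrite (@Ex_prod_indep _ _ _ P _ _ measurable_coords indep [set inr (n : nat)] (past n)
    (fun w => Num.min (S n w) b))//.
  - rewrite ler_wpM2r//; first by case/andP: (Ex_waiting01 n).
    exact: (Ex_min_exponential_ge lam0 b0 (mS n) (S0 n) (lawS n)).
  - by apply/seteqP; split=> // i [/= ->] /=; rewrite ltnn.
  - exact: sub_measurable_minS.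
  - by apply: sub_measurable_indic; exact: sub_measurable_waiting.
  - exact: bmf_minS.
  - exact: bmf_waiting.
move: (\sum_(n < K) _) => s {}h; have lamN0 : lam != 0 by rewrite gt_eqF.
have -> : s = 4 / 3 * lam * (3 / 4 / lam * s) by field.
have -> : 4 / 3 * (lam * T + 2) = 4 / 3 * lam * (T + b) by field.
by rewrite ler_pM2l// mulr_gt0.
Qed.

(** Capping idle times at [T] keeps the terms bounded and loses nothing here. The factor on the left
    discards the paths that have not passed the horizon by step [K]. *)
Lemma elapsed_ge K w :
  T * (1 - \1_(active K) w) <=
  \sum_(n < K) (Num.min (S n w) T + X n w * a n w) * \1_(active n) w.
Proof.
have term0 n : 0 <= Num.min (S n w) T + X n w * a n w.
  rewrite addr_ge0//; first by rewrite le_min S0 ltW.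
  by rewrite mulr_ge0//; [case/andP: (X0C n w)|case/andP: (alg_a01 n w)].
have sum0 (Q : pred 'I_K) :
    0 <= \sum_(n < K | Q n) (Num.min (S n w) T + X n w * a n w) * \1_(active n) w.
  by apply: sumr_ge0 => n _; rewrite mulr_ge0//; case/andP: (indic01 (active n) w).
rewrite [in X in X <= _]indicE; have [_|nA] := boolP (w \in active K).
  by rewrite subrr mulr0 sum0.
rewrite subr0 mulr1.
have [exm|noroot] := pselect (exists m, (m < K)%N && (T < elapsed lam r X S m w)); last first.
  move: nA; rewrite notin_setE => nA; exfalso; apply: nA => m mK.
  by rewrite leNgt; apply/negP => Tm; apply: noroot; exists m; rewrite mK.
case: (ex_minnP exm) => m /andP[mK Tm] mmin.
have act n : (n < m.+1)%N -> active n w.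
  rewrite ltnS => nm k kn; rewrite leNgt; apply/negP => Tk.
  have km : (k < m)%N := leq_trans kn nm.
  by have := mmin k; rewrite Tk (ltn_trans km mK) leqNgt km => /(_ isT).
rewrite (bigID (fun n : 'I_K => (n < m.+1)%N))/= ler_wpDr//.
rewrite -(big_ord_widen_cond _ (fun=> true)
  (fun n => (Num.min (S n w) T + X n w * a n w) * \1_(active n) w) mK)/=.
rewrite (eq_bigr (fun n : 'I_m.+1 => Num.min (S n w) T + X n w * a n w)); last first.
  by move=> i _; rewrite indicE mem_set ?mulr1//; exact: act.
(* Either one capped idle time contributes [T] alone, or no cap is effective and the sum is the
   elapsed time at [m], which exceeds [T]. *)
have [[i im Ti]|small] := pselect (exists2 i, (i < m.+1)%N & T <= S i w).
  rewrite (bigD1 (Ordinal im))//= (min_r Ti) -addrA lerDl addr_ge0//.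
    by rewrite mulr_ge0//; [case/andP: (X0C i w)|case/andP: (alg_a01 i w)].
  exact: sumr_ge0.
apply: le_trans (ltW Tm) _; apply: ler_sum => i _; rewrite min_l//.
by rewrite leNgt; apply/negP => /ltW Ti; apply: small; exists i.
Qed.

(** One summand of Wald's identity for the gains: [active n] is determined before [X n] is
    observed. *)
Lemma Ex_active_gain n : Ex (fun w => gain n w * \1_(active n) w) = mu * Ex (\1_(active n)).
Proof.
rewrite (@Ex_prod_indep _ _ _ P _ _ measurable_coords indep [set inl n] (past n) (gain n))//.
- by rewrite Ex_gain.
- by apply/seteqP; split=> // i [/= ->] /=; rewrite ltnn.
- exact: sub_measurable_gain.
- by apply: sub_measurable_indic; exact: sub_measurable_active.
- exact: bmf_gaincs.
- exact: bmf_active.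
Qed.

Lemma Ex_active_wait n :
  Ex (fun w => Num.min (S n w) T * \1_(active n) w) <= lam^-1 * Ex (\1_(active n)).
Proof.
rewrite (@Ex_prod_indep _ _ _ P _ _ measurable_coords indep [set inr n] (past n)
  (fun w => Num.min (S n w) T))//.
- rewrite ler_wpM2r//.
    by apply: Ex_ge0 => w; case/andP: (indic01 (active n) w).
  exact: (Ex_min_exponential_le lam0 T0 (mS n) (S0 n) (lawS n)).
- by apply/seteqP; split=> // i [/= ->] /=; rewrite ltnn.
- exact: sub_measurable_minS.
- by apply: sub_measurable_indic; exact: sub_measurable_active.
- exact: bmf_minS.
- exact: bmf_active.
Qed.

(** [active n] is correlated with the deviation through the durations, whereas
    [waiting n] is independent of it. *)
Lemma Ex_active_deviation n :
  Ex (fun w => `|deviation n.+1 w| * \1_(active n) w) <=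
  Num.sqrt n.+1%:R * (D / 2) * Ex (\1_(waiting n)).
Proof.
have bV := bmf_norm (bmf_deviation n.+1).
apply: (@le_trans _ _ (Ex (fun w => `|deviation n.+1 w| * \1_(waiting n) w))).
  apply: Ex_le => [||w].
  - by apply: bmfM => //; exact: bmf_active.
  - by apply: bmfM => //; exact: bmf_waiting.
  - rewrite ler_wpM2l// !indicE ler_nat.
    by case: (boolP (w \in active n)) => // /set_mem/active_waiting wn; rewrite mem_set.
rewrite (@Ex_prod_indep _ _ _ P _ _ measurable_coords indep
  [set i | if i is inl _ then true else false] [set i | if i is inr _ then true else false]
  (fun w => `|deviation n.+1 w|))//.
- rewrite ler_wpM2r ?Ex_deviation_abs//.
  by case/andP: (Ex_waiting01 n).
- by apply/seteqP; split=> // -[m|m] [].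
- by apply: measurableT_comp => //; exact: sub_measurable_deviation.
- by apply: sub_measurable_indic; exact: sub_measurable_waiting.
- exact: bmf_waiting.
Qed.

(** * The regret bound for finitely many steps, and its limit *)

Local Notation M := (4 / 3 * (lam * T + 2)).

Lemma regret_upto_le K :
  cs * T * (1 - Ex (\1_(active K))) - Ex (reward_upto K) <=
  lam * C * D * (Num.sqrt M - 2^-1).
Proof.
have [cs0 csE] := cstarP.
(* Pricing the time in [elapsed_ge] at rate [cs] and inserting [regret_step_le] leaves three parts
   per step: idle cost, minus gain, plus estimation error. *)
pose Q n w := cs * (Num.min (S n w) T * \1_(active n) w) +
  ((-1) * (gain n w * \1_(active n) w) +
   (lam * C * n.+1%:R^-1) * (`|deviation n.+1 w| * \1_(active n) w)).
have b1 n : bounded_measurable (fun w => Num.min (S n w) T * \1_(active n) w).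
  by apply: bmfM; [exact: bmf_minS|exact: bmf_active].
have b2 n : bounded_measurable (fun w => gain n w * \1_(active n) w).
  by apply: bmfM; [exact: bmf_gaincs|exact: bmf_active].
have b3 n : bounded_measurable (fun w => `|deviation n.+1 w| * \1_(active n) w).
  by apply: bmfM; [apply: bmf_norm; exact: bmf_deviation|exact: bmf_active].
have bQ n : bounded_measurable (Q n).
  by apply: bmfD; [exact: bmfZ|apply: bmfD; exact: bmfZ].
have bA : bounded_measurable (fun w => cs * T * (1 - \1_(active K) w)).
  by apply: bmfZ; apply: bmfB; [exact: bmf_cst|exact: bmf_active].
have -> : cs * T * (1 - Ex (\1_(active K))) - Ex (reward_upto K) =
    Ex (fun w => cs * T * (1 - \1_(active K) w) - reward_upto K w).
  rewrite ExB//; last exact: bmf_reward_upto.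
  rewrite ExZ; last by apply: bmfB; [exact: bmf_cst|exact: bmf_active].
  by rewrite ExB ?Ex_cst//; [exact: bmf_cst|exact: bmf_active].
apply: (@le_trans _ _ (Ex (fun w => \sum_(n < K) Q n w))).
  apply: Ex_le => [||w].
  - by apply: bmfB => //; exact: bmf_reward_upto.
  - exact: (@bmf_sum _ _ _ K Q).
  - rewrite -mulrA lerBlDr (le_trans (ler_wpM2l cs0 (elapsed_ge K w)))//.
    rewrite /reward_upto -big_split/= mulr_sumr; apply: ler_sum => n _.
    have := regret_step_le n w; have /andP[i0 _] := indic01 (active n) w.
    rewrite /Q; move: (\1_(active n) w : R) i0 => i i0 h.
    have := ler_wpM2r i0 h; move: (n.+1%:R^-1) (gain n w) (r (X n w)) (X n w).
    by move: (a n w) (`|deviation n.+1 w|) (Num.min _ _) => *; lra.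
rewrite (@Ex_sum _ _ _ P K Q)//.
have step n : Ex (Q n) <=
    lam * C * D * (Ex (\1_(waiting n)) * (2 * Num.sqrt n.+1%:R)^-1).
  rewrite ExD; [|exact: bmfZ|by apply: bmfD; exact: bmfZ].
  rewrite ExD; [|exact: bmfZ|exact: bmfZ].
  rewrite !ExZ// Ex_active_gain.
  have h1 := ler_wpM2l cs0 (Ex_active_wait n).
  have k0 : 0 <= lam * C * n.+1%:R^-1.
    by rewrite !mulr_ge0// ltW.
  have h2 := ler_wpM2l k0 (Ex_active_deviation n).
  have lamN0 : lam != 0 by rewrite gt_eqF.
  (* By the equation for [cs], the mean gain offsets the bound [cs / lam] on the mean idle cost;
     only the estimation error survives. *)
  have muE : mu = cs * lam^-1.
    by apply: (mulfI lamN0); rewrite mulrCA mulfV// mulr1; move: csE; lra.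
  rewrite muE in h1 *.
  have q0 : Num.sqrt n.+1%:R != 0 :> R by rewrite gt_eqF// sqrtr_gt0 ltr0n.
  have qE : n.+1%:R = Num.sqrt n.+1%:R ^+ 2 :> R by rewrite sqr_sqrtr// ler0n.
  have qV : n.+1%:R^-1 * Num.sqrt n.+1%:R = (Num.sqrt n.+1%:R)^-1 :> R.
    by rewrite {1}qE; field.
  rewrite invfM -qV; move: h1 h2; move: (Ex _) (Ex _) (Ex _) (Ex _) (Num.sqrt _).
  by move: (n.+1%:R^-1) => *; lra.
apply: (@le_trans _ _ (\sum_(n < K) lam * C * D *
    (Ex (\1_(waiting n)) * (2 * Num.sqrt n.+1%:R)^-1))).
  by apply: ler_sum => n _; exact: step.
rewrite -mulr_sumr; apply: ler_wpM2l; first by rewrite !mulr_ge0// ltW.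
apply: (@weighted_sum_half_invsqrt _ (fun n => Ex (\1_(waiting n)))).
- exact: Ex_waiting01.
- by have := mulr_gt0 lam0 T0; lra.
- exact: sum_Ex_waiting.
Qed.

(** The event [active n] lies in each of the [n.+1] events [waiting i] with [i <= n], whose
    probabilities sum to at most [M]. *)
Lemma Ex_active_le n : Ex (\1_(active n)) <= M * n.+1%:R^-1.
Proof.
rewrite ler_pdivlMr ?ltr0n//; apply: le_trans (sum_Ex_waiting n.+1).
rewrite mulr_natr -[in leLHS](card_ord n.+1) -sumr_const; apply: ler_sum => i _.
apply: Ex_le => [||w]; [exact: bmf_active|exact: bmf_waiting|].
rewrite !indicE ler_nat; case: (boolP (w \in active n)) => // /set_mem aw.
rewrite mem_set//; apply: active_waiting.
by apply: (below_mono _ aw); rewrite -ltnS.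
Qed.

Lemma Ex_active_cvg0 : Ex (\1_(active n)) @[n --> \oo] --> 0.
Proof.
apply: (@squeeze_cvgr _ _ _ _ (fun=> 0) (fun n => M * n.+1%:R^-1)).
- near=> n; rewrite Ex_active_le andbT.
  by apply: Ex_ge0 => w; case/andP: (indic01 (active n) w).
- exact: cvg_cst.
- rewrite -[X in _ --> X](mulr0 M); apply: cvgMr; exact: cvg_harmonic.
Unshelve. all: by end_near. Qed.

Lemma active_forever_negligible : P (\bigcap_n active n) = 0%E.
Proof.
have mA : measurable (\bigcap_n active n).
  by apply: bigcapT_measurable => n; exact: measurable_active.
apply/eqP; rewrite -[P _]fineK ?fin_num_measure// eqe eq_le.
rewrite fine_ge0 ?measure_ge0// andbT.
have h n : fine (P (\bigcap_n active n)) <= Ex (\1_(active n)).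
  rewrite Ex_indic; last exact: measurable_active.
  rewrite fine_le ?fin_num_measure//; first exact: measurable_active.
  rewrite le_measure ?inE//; first exact: measurable_active.
  by move=> w; exact.
rewrite -(cvg_lim _ Ex_active_cvg0)//; apply: limr_ge; first exact: (cvgP _ Ex_active_cvg0).
by near=> n; exact: h.
Unshelve. all: by end_near. Qed.

(** The dominating function for [reward_upto]: the largest possible reward size times the number of
    truncated idle times. *)
Lemma integrable_waiting_time :
  P.-integrable setT (fun w => (D - E)%:E * \sum_(0 <= n <oo) (\1_(waiting n) w)%:E)%E.
Proof.
have DE0 : 0 <= D - E by rewrite subr_ge0 (le_trans E0).
have m1 n : measurable_fun setT (fun w => (\1_(waiting n) w : R)%:E).
  by apply/measurable_EFinP; have [] := bmf_waiting n.
have pos n w : (0 <= (\1_(waiting n) w : R)%:E)%E.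
  by rewrite lee_fin; case/andP: (indic01 (waiting n) w).
have msum : measurable_fun setT (fun w => \sum_(0 <= n <oo) (\1_(waiting n) w : R)%:E)%E.
  by apply: ge0_emeasurable_sum.
have sum0 w : (0 <= \sum_(0 <= n <oo) (\1_(waiting n) w : R)%:E)%E by apply: nneseries_ge0.
apply/integrableP; split; first exact: emeasurable_funM.
under eq_integral do rewrite gee0_abs ?mule_ge0//.
rewrite ge0_integralZl// integral_nneseries//.
apply: (@le_lt_trans _ _ ((D - E)%:E * M%:E)%E); last by rewrite -EFinM ltry.
rewrite lee_wpmul2l ?lee_fin//; apply: lime_le.
  by apply: is_cvg_nneseries => n _ _; exact: integral_ge0.
near=> n; rewrite big_mkord (eq_bigr (fun i : 'I_n => (Ex (\1_(waiting i)))%:E)).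
  by rewrite sumEFin lee_fin; exact: sum_Ex_waiting.
by move=> i _; rewrite EFin_Ex//; exact: bmf_waiting.
Unshelve. all: by end_near. Qed.

Lemma reward_upto_le K w :
  (`|(reward_upto K w)%:E| <=
   (D - E)%:E * \sum_(0 <= n <oo) (\1_(waiting n) w)%:E)%E.
Proof.
have DE0 : 0 <= D - E by rewrite subr_ge0 (le_trans E0).
have pos n : (0 <= (\1_(waiting n) w : R)%:E)%E.
  by rewrite lee_fin; case/andP: (indic01 (waiting n) w).
apply: (@le_trans _ _ ((D - E)%:E * \sum_(0 <= n < K) (\1_(waiting n) w : R)%:E)%E); last first.
  by rewrite lee_wpmul2l ?lee_fin//; apply: nneseries_lim_ge.
rewrite big_mkord sumEFin -EFinM lee_fin mulr_sumr (le_trans (ler_norm_sum _ _ _))//.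
apply: ler_sum => n _; rewrite normrM ler_pM ?reward_norm_le//.
rewrite !indicE normr_nat ler_nat.
by case: (boolP (w \in active n)) => // /set_mem/active_waiting wn; rewrite mem_set.
Qed.

(** Limit of [regret_upto_le]: the probability of [active K] tends to 0, and the rewards converge by
    domination. *)
Lemma nonneg_regret_le :
  (regret P lam T r X S <= (lam * C * D * (Num.sqrt M - 2^-1))%:E)%E.
Proof.
have [||||itot _ cvgE] := @dominated_convergence _ _ _ P setT measurableT
  (fun K w => (reward_upto K w)%:E) (fun w => (total_reward lam T r X S w)%:E) _ _ _ _
  integrable_waiting_time.
- by move=> K; apply/measurable_EFinP; have [] := bmf_reward_upto K.
- by apply/measurable_EFinP; exact: measurable_total_reward.
- exists (\bigcap_n active n); split.
  + by apply: bigcapT_measurable => n; exact: measurable_active.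
  + exact: active_forever_negligible.
  + move=> w /= h; apply: contrapT => nA; apply: h => _.
    by apply: cvg_EFin; [exact: nearW|exact: reward_upto_cvg].
- by apply: aeW => w n _; exact: reward_upto_le.
rewrite /regret /U unlock.
have ufin := integrable_fin_num measurableT itot.
move: cvgE ufin; set u := (\int[P]_w _)%E => cvgE ufin.
rewrite -(fineK ufin) -EFinB lee_fin; rewrite -(fineK ufin) in cvgE.
have cvgR : Ex (reward_upto n) @[n --> \oo] --> fine u by exact: (fine_cvg cvgE).
have cvgL : cs * T * (1 - Ex (\1_(active n))) - Ex (reward_upto n) @[n --> \oo] -->
    cs * T * (1 - 0) - fine u.
  apply: cvgB => //; apply: cvgMr; apply: cvgB; first exact: cvg_cst.
  exact: Ex_active_cvg0.
rewrite subr0 mulr1 in cvgL; apply: (cvgr_to_le cvgL).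
by near=> n; exact: regret_upto_le.
Unshelve. all: by end_near. Qed.

Lemma nonneg_regret_bound :
  (regret P lam T r X S <=
   (lam * (D - E) * C * Num.sqrt (pi / 2) * Num.sqrt (lam * T + 1))%:E)%E.
Proof.
apply: le_trans nonneg_regret_le _; rewrite lee_fin.
have hb := sqrt_horizon_bound (ltW (mulr_gt0 lam0 T0)).
apply: (@le_trans _ _ (lam * C * D * (Num.sqrt (pi / 2) * Num.sqrt (lam * T + 1)))).
  by rewrite ler_wpM2l// !mulr_ge0// ltW.
rewrite [leRHS](_ : _ = lam * C * (D - E) *
  (Num.sqrt (pi / 2) * Num.sqrt (lam * T + 1))); last by ring.
rewrite ler_wpM2r ?mulr_ge0 ?sqrtr_ge0// ler_wpM2l//; first by rewrite mulr_ge0// ltW.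
(* This is [D <= D - E], from [E <= 0]. *)
by rewrite lerBrDr gerDl.
Qed.

End policy.

(** * Reduction to idle times that are nonnegative everywhere *)

Section positive_part.
Context {d : measure_display} {Omega : measurableType d} {R : realType}.
Context (P : probability Omega R).
Variables (lam T : R) (r : R -> R) (X S : nat -> Omega -> R).

(** The exponential law makes [S n] nonnegative only almost surely; the arguments on paths require
    it at every point. *)
Definition pos_part (n : nat) (w : Omega) : R := Num.max (S n w) 0.

(** The density vanishes on negative numbers, and the positive part fixes all others. *)
Lemma exponential_prob_pos_part (B : set R) :
  exponential_prob lam ((fun x => Num.max x 0) @^-1` B) = exponential_prob lam B.
Proof.
rewrite /exponential_prob integral_mkcond [RHS]integral_mkcond.
apply: eq_integral => x _; rewrite !patchE.
have [x0|x0] := ltP x 0; first by rewrite lt0_exponential_pdf//; case: ifP; case: ifP.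
suff -> : (x \in (fun x => Num.max x 0) @^-1` B) = (x \in B) by [].
by apply/idP/idP; rewrite !inE/= max_l.
Qed.

Lemma total_reward_pos_part w : (forall n, 0 <= S n w) ->
  total_reward lam T r X pos_part w = total_reward lam T r X S w.
Proof.
move=> S0; have elE n : elapsed lam r X pos_part n w = elapsed lam r X S n w.
  by apply: eq_bigr => i _; rewrite /pos_part max_l.
rewrite /total_reward /theta.
suff -> : [set n | T < elapsed lam r X pos_part n w /\
    forall m, (m < n)%N -> elapsed lam r X pos_part m w <= T] =
  [set n | T < elapsed lam r X S n w /\
    forall m, (m < n)%N -> elapsed lam r X S m w <= T] by [].
by apply/seteqP; split=> n /= [Tn nT]; split => [|m /nT];
  rewrite ?elE// -?elE.
Qed.

Lemma independent_pos_part :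
  mutually_independent P (coords X S) -> mutually_independent P (coords X pos_part).
Proof.
move=> indep J B uJ mB.
pose B' (i : nat + nat) :=
  match i with inl _ => B i | inr _ => (fun x => Num.max x 0) @^-1` B i end.
have mB' i : measurable (B' i).
  case: i => n //=; rewrite -[X in measurable X]setTI.
  have : measurable_fun setT (fun x : R => Num.max x 0) by exact: measurable_maxr.
  by apply.
have BE i : coords X pos_part i @^-1` B i = coords X S i @^-1` B' i by case: i.
under eq_bigr do rewrite BE; under [in RHS]eq_bigr do rewrite BE.
exact: indep.
Qed.

End positive_part.

Unset Implicit Arguments.

Theorem theorem3p2 (R : realType) (d : measure_display)
  (Omega : measurableType d) (P : probability Omega R)
  (C lam E D T : R) (r : R -> R) (X S : nat -> Omega -> R) :
  0 < C -> 0 < lam -> E <= 0 -> 0 <= D -> 0 < T ->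
  (forall x, 0 <= x <= C -> E <= r x <= D) ->
  measurable_fun `[0, C] r ->
  (forall n, measurable_fun setT (X n)) ->
  (forall n, measurable_fun setT (S n)) ->
  (forall n w, 0 <= X n w <= C) ->
  (forall n (B : set R), measurable B -> P (X n @^-1` B) = P (X 0%N @^-1` B)) ->
  (forall n (B : set R), measurable B ->
     P (S n @^-1` B) = exponential_prob lam B) ->
  mutually_independent P
    (fun i : nat + nat => match i with inl n => X n | inr n => S n end) ->
  (regret P lam T r X S <=
   (lam * (D - E) * C * Num.sqrt (pi / 2) * Num.sqrt (lam * T + 1))%:E)%E.
Proof.
move=> C0 lam0 E0 D0 T0 rED mr mX mS X0C lawX lawS indep.
have mg : measurable_fun setT (fun x : R => Num.max x 0) by exact: measurable_maxr.
have mS' n : measurable_fun setT (pos_part S n) by exact: measurable_maxr.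
have S'0 n w : 0 <= pos_part S n w by rewrite /pos_part le_max lexx orbT.
have lawS' n (B : set R) : measurable B -> P (pos_part S n @^-1` B) = exponential_prob lam B.
  move=> mB; rewrite -exponential_prob_pos_part -(lawS n)//.
  by rewrite -[X in measurable X]setTI; exact: mg.
have neg0 n : P.-negligible [set w | S n w < 0].
  have -> : [set w | S n w < 0] = S n @^-1` `]-oo, 0[.
    by apply/seteqP; split=> w; rewrite /= in_itv.
  apply/negligibleP; first by rewrite -[X in measurable X]setTI; exact: mS.
  apply: etrans (lawS n _ (measurable_itv _)) _; rewrite /exponential_prob integral0_eq// => x.
  by rewrite /= in_itv/= => x0; rewrite lt0_exponential_pdf.
(* The root [cstar] does not involve the idle times, and the total rewards agree outside the
   countable union of the null events [S n w < 0]. *)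
have -> : regret P lam T r X S = regret P lam T r X (pos_part S).
  rewrite /regret /U unlock; congr (_ - _)%E; apply: ae_eq_integral => //.
  - by apply/measurable_EFinP; exact: (measurable_total_reward T lam0 E0 D0 rED).
  - by apply/measurable_EFinP; exact: (measurable_total_reward T lam0 E0 D0 rED).
  - apply: negligibleS (negligible_bigcup neg0) => w /= h.
    apply: contrapT => nneg; apply: h => _; rewrite total_reward_pos_part// => n.
    by rewrite leNgt; apply/negP => Sn; apply: nneg; exists n.
apply: (nonneg_regret_bound C0 lam0 E0 D0 rED) => //.
exact: independent_pos_part.
Qed.
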